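(* Let $n\ge 2$ and $q\ge 0$. For each partition $\lambda\vdash n$ of length $q+1$ with no part equal to $1$ or $n$, let $V(\lambda)\subseteq \widetilde H_q(X(n),\mathbb Z)$ be the $\mathbb Z$-span of the (classes of the) oriented facets of shape $\lambda$. Then $V(\lambda)$ is a $\mathbb ZS_n$-submodule and there is an isomorphism of $\mathbb ZS_n$-modules $$V(\lambda)\cong V\uparrow_{N_\lambda}^{S_n},$$ and consequently $$\widetilde H_q(X(n),\mathbb Z)\cong\bigoplus_{\lambda} V\uparrow_{N_\lambda}^{S_n},$$ the sum running over all partitions $\lambda\vdash n$ of length $q+1$ having no parts of size $1$ or $n$.
   Context: $X(n)$ ($n\ge 2$) is the simplicial complex whose vertices are the proper non-empty subsets of $[n]=\{1,\dots,n\}$ and whose $q$-faces are sets of $q+1$ pairwise disjoint proper non-empty subsets of $[n]$; its facets are the partitions of $[n]$ into at least two blocks. The reduced homology $\widetilde H_q(X(n),\mathbb Z)$ is free abelian with basis in bijection with the facets $x_0\ldots x_q$ all of whose blocks have size $\ge 2$. Totally order the vertices by decreasing size, and lexicographically among subsets of equal size; an oriented $q$-face is written $x_0x_1\ldots x_q$ with $x_0<\dots<x_q$ in this order. $S_n$ acts on chains by $g\cdot x_0\ldots x_q=\operatorname{sgn}(\pi)\,y_0\ldots y_q$ where $(gx_0)\ldots(gx_q)=y_{\pi(0)}\ldots y_{\pi(q)}$ with $y_0\ldots y_q$ oriented; this induces an action on homology. The shape of a facet $x_0\ldots x_q$ is the partition $(|x_0|,\dots,|x_q|)\vdash n$. For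 $\lambda=(\lambda_0,\dots,\lambda_q)\vdash n$, let $x_0=\{1,\dots,\lambda_0\}$, $x_1=\{\lambda_0+1,\dots,\lambda_0+\lambda_1\}$, etc., be the minimal oriented face of shape $\lambda$; $S_\lambda\cong S_{\lambda_0}\times\cdots\times S_{\lambda_q}$ is the Young subgroup permuting each $x_i$ within itself, and $N_\lambda$ its normaliser in $S_n$. Writing $\lambda=(\mu_1^{a_1},\dots,\mu_r^{a_r})$ with distinct part sizes $\mu_j$ of multiplicity $a_j$, each $g\in N_\lambda$ permutes the blocks $x_0,\dots,x_q$ (blocks of equal size among themselves), giving a homomorphism $N_\lambda\to N_\lambda/S_\lambda\cong S_{a_1}\times\cdots\times S_{a_r}$, $g\mapsto\bar g$, with $g\cdot x_0\ldots x_q=x_{\bar g0}\ldots x_{\bar gq}$ as sets; $\operatorname{sgn}(\bar g)$ is the sign of $\bar g$ as a permutation of $\{0,\dots,q\}$. $V=\mathbb Z v$ is the rank-one $\mathbb ZN_\lambda$-module with $g\cdot v=\operatorname{sgn}(\bar g)v$, and $V\uparrow_{N_\lambda}^{S_n}$ is the induced module. *)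

(* Defs.v *)
From mathcomp Require Import all_boot all_order all_algebra all_fingroup.
Set Implicit Arguments. Unset Strict Implicit. Unset Printing Implicit Defensive.
Import GRing.Theory.
Local Open Scope ring_scope.

Section XComplex.
Variable n : nat.

Local Notation vertex := {set 'I_n}.
Local Notation faceT := {set {set 'I_n}}.

Fixpoint lexlt (s t : seq nat) : bool :=
  match s, t with
  | a :: s', b :: t' => (a < b)%N || ((a == b) && lexlt s' t')
  | [::], _ :: _ => true
  | _, _ => false
  end.

Definition vlt (x y : vertex) : bool :=
  (#|y| < #|x|)%N ||
  ((#|x| == #|y|) && lexlt [seq val i | i <- enum x] [seq val i | i <- enum y]).

(* faces of X(n) (including the empty face, used for reduced homology) *)
Definition isface (s : faceT) : bool :=
  [forall x in s, (x != set0) && (x != setT)] &&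
  [forall x in s, forall y in s, (x != y) ==> [disjoint x & y]].

(* facets = partitions of [n] (into at least two proper blocks) *)
Definition isfacet (s : faceT) : bool :=
  isface s && (\bigcup_(x in s) x == setT).

Definition facet_of_shape (lam : seq nat) (s : faceT) : bool :=
  isfacet s && perm_eq (map (fun x : {set 'I_n} => #|x|) (enum s)) lam.

Definition chain := {ffun faceT -> int}.

Definition deg (q : nat) (f : chain) : Prop :=
  forall s, f s != 0 -> isface s && (#|s| == q.+1)%N.

Definition vrank (x : vertex) (s : faceT) : nat := #|[set y in s | vlt y x]|.

(* simplicial boundary on oriented faces x_0...x_q (augmented: the boundary
   of a vertex is the empty face, giving reduced homology) *)
Definition bd (f : chain) : chain :=
  [ffun t : faceT => \sum_(x : vertex | (x \notin t) && isface (x |: t))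
               (-1) ^+ (vrank x (x |: t)) * f (x |: t)].

Definition zcycle (q : nat) (f : chain) : Prop := deg q f /\ bd f = 0.
Definition boundary (q : nat) (f : chain) : Prop :=
  exists g, deg q.+1 g /\ f = bd g.

Definition vact (g : 'S_n) (x : vertex) : vertex := [set g i | i in x].
Definition fact (g : 'S_n) (s : faceT) : faceT := [set vact g x | x in s].

(* sign of the permutation pi with (g x_0)...(g x_q) = y_{pi 0}...y_{pi q}:
   parity of the number of inversions *)
Definition fsign (g : 'S_n) (s : faceT) : int :=
  (-1) ^+ #|[set p : vertex * vertex | [&& p.1 \in s, p.2 \in s, vlt p.1 p.2
                                           & vlt (vact g p.2) (vact g p.1)]]|.

(* g . (x_0...x_q) = sgn(pi) y_0...y_q, extended linearly *)
Definition cact (g : 'S_n) (f : chain) : chain :=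
  [ffun t => fsign g (fact g^-1 t) * f (fact g^-1 t)].

Definition valid_shape (q : nat) (lam : seq nat) : bool :=
  [&& sorted geq lam, sumn lam == n, size lam == q.+1
    & all (fun a => (1 < a < n)%N) lam].

(* blocks of the minimal oriented face of shape lam *)
Definition blk (lam : seq nat) (i : nat) : vertex :=
  [set j : 'I_n | (sumn (take i lam) <= j < sumn (take i.+1 lam))%N].

Definition young (lam : seq nat) : {set 'S_n} :=
  [set g : 'S_n | all (fun i => vact g (blk lam i) == blk lam i) (iota 0 (size lam))].

Definition Nlam (lam : seq nat) : {set 'S_n} := ('N(young lam))%g.

Definition gbar (lam : seq nat) (g : 'S_n) (i : nat) : nat :=
  find (fun j => vact g (blk lam i) == blk lam j) (iota 0 (size lam)).

(* sgn(gbar), as the parity of the number of inversions of gbar *)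
Definition eps (lam : seq nat) (g : 'S_n) : int :=
  (-1) ^+ (\sum_(i < size lam) \sum_(j < size lam)
             ((i < j)%N && (gbar lam g j < gbar lam g i)%N))%N.

(* induced module V ^{S_n}_{N_lam}, modelled as functions F : S_n -> Z with
   F (k * g) = eps k * F g for k in N_lam (with mathcomp's product, in which
   chains above also form a module: cact g (cact h f) = cact (h * g) f) *)
Definition indmod (lam : seq nat) (F : {ffun 'S_n -> int}) : Prop :=
  forall k g, k \in Nlam lam -> F (k * g)%g = eps lam k * F g.

Definition indact (x : 'S_n) (F : {ffun 'S_n -> int}) : {ffun 'S_n -> int} :=
  [ffun y => F (y * x^-1)%g].

(* direct sum over all valid shapes lam of length q+1 (parts are < n, so
   they are indexed by (q+1)-tuples over 'I_n); other components vanish *)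
Definition summod (q : nat) (F : {ffun (q.+1).-tuple 'I_n -> {ffun 'S_n -> int}})
  : Prop :=
  forall t : (q.+1).-tuple 'I_n,
    if valid_shape q [seq val i | i <- t] then indmod [seq val i | i <- t] (F t)
    else F t = 0.

Definition sumact (q : nat) (x : 'S_n)
  (F : {ffun (q.+1).-tuple 'I_n -> {ffun 'S_n -> int}}) :=
  [ffun t => indact x (F t)].

(* span of classes of facets of shape lam: classes of cycles whose facet
   coefficients vanish off facets of shape lam *)
Definition Vlam (q : nat) (lam : seq nat) (z : chain) : Prop :=
  zcycle q z /\ forall s, isfacet s -> z s != 0 -> facet_of_shape lam s.

(* (Zs mod Bs) is isomorphic, as a Z S_n-module, to the module W:
   phi is additive and equivariant on Zs, with kernel Bs, onto W. *)
Definition ZSn_iso (T : zmodType) (Zs Bs : chain -> Prop)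
  (W : T -> Prop) (actW : 'S_n -> T -> T) : Prop :=
  exists phi : chain -> T,
  [/\ forall z, Zs z -> W (phi z),
      forall z1 z2, Zs z1 -> Zs z2 -> phi (z1 + z2) = phi z1 + phi z2,
      forall z, Zs z -> (phi z = 0 <-> Bs z),
      forall w, W w -> exists2 z, Zs z & phi z = w
    & forall g z, Zs z -> phi (cact g z) = actW g (phi z)].

End XComplex.

(* Main.v *)
(** The facets carry no boundary, so the facet coefficients of a cycle depend
only on its homology class; they vanish on facets with a singleton block.
Conversely, the faces that leave a point uncovered or contain a singleton block
form an acyclic subcomplex: toggling the singleton [{k}], where [k] is the
smallest point that is uncovered or a singleton block, is an acyclic matching on
all of them, including the empty face.  Hence a class is determined by its
coefficients on the singleton-free facets, and these can be prescribed freely.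
The group acts on the coefficients by signed permutation, the facets of shape
[lam] form one orbit, and the stabiliser [N_lam] of the minimal one acts on its
orientation through [eps].  So [g |-> sgn * z (g . minimal face)] identifies the
coefficients of shape [lam] with the induced module. *)

Require Import Defs.
From mathcomp Require Import all_boot all_order all_algebra all_fingroup.
From mathcomp Require Import zify ring.

Set Implicit Arguments. Unset Strict Implicit. Unset Printing Implicit Defensive.
Import GRing.Theory.
Local Open Scope ring_scope.

(** * Orientation signs *)

Section Signs.
Variable n : nat.
Implicit Types (x y : {set 'I_n}) (s t : {set {set 'I_n}}) (g h : 'S_n).

Lemma lexlt_total (a b : seq nat) : a != b -> lexlt a b = ~~ lexlt b a.
Proof.
elim: a b => [|i a IH] [|j b] //=; rewrite eqseq_cons (eq_sym j).
by case: (ltngtP i j) => //= _ /IH.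
Qed.

Lemma lexlt_irr (a : seq nat) : lexlt a a = false.
Proof. by elim: a => //= i a ->; rewrite ltnn eqxx. Qed.

Lemma vlt_irr x : vlt x x = false.
Proof. by rewrite /vlt ltnn lexlt_irr andbF. Qed.

Lemma vlt_total x y : x != y -> vlt x y = ~~ vlt y x.
Proof.
move=> neq_xy; rewrite /vlt; case: ltngtP => //= _; apply: lexlt_total.
apply: contra neq_xy => /eqP /(inj_map val_inj) e; apply/eqP/setP => i.
by rewrite -[LHS]mem_enum e mem_enum.
Qed.

Lemma vlt_asym x y : vlt x y -> vlt y x = false.
Proof.
have [->|/vlt_total ->] := eqVneq x y; first by rewrite vlt_irr.
by move/negbTE.
Qed.

Lemma vrankE x s : vrank x s = (\sum_(y in s) vlt y x)%N.
Proof.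
rewrite /vrank -sum1_card big_mkcond [RHS]big_mkcond.
by apply: eq_bigr => y _; rewrite inE; case: (y \in s) => //; case: vlt.
Qed.

Lemma vrankU1 x y t : y \notin t -> vrank x (y |: t) = (vlt y x + vrank x t)%N.
Proof. by move=> yt; rewrite !vrankE big_setU1. Qed.

Lemma vrank_self x t : x \notin t -> vrank x (x |: t) = vrank x t.
Proof. by move=> xt; rewrite vrankU1 // vlt_irr. Qed.

Lemma vact1 x : vact 1 x = x.
Proof. by rewrite /vact (eq_imset _ (@perm1 _)) imset_id. Qed.

Lemma vactM g h x : vact (g * h)%g x = vact h (vact g x).
Proof. by rewrite /vact -imset_comp; apply: eq_imset => i; rewrite /= permM. Qed.

Lemma vactK g : cancel (vact g) (vact g^-1).
Proof. by move=> x; rewrite -vactM mulgV vact1. Qed.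

Lemma vactVK g : cancel (vact g^-1) (vact g).
Proof. by move=> x; rewrite -vactM mulVg vact1. Qed.

Lemma vact_inj g : injective (vact g).
Proof. exact: can_inj (vactK g). Qed.

Lemma factM g h s : fact (g * h) s = fact h (fact g s).
Proof. by rewrite /fact -imset_comp; apply: eq_imset => x; rewrite /= vactM. Qed.

Lemma fact1 s : fact 1 s = s.
Proof. by rewrite /fact (eq_imset _ vact1) imset_id. Qed.

Lemma factK g : cancel (fact g) (fact g^-1).
Proof. by move=> s; rewrite -factM mulgV fact1. Qed.

Lemma factVK g : cancel (fact g^-1) (fact g).
Proof. by move=> s; rewrite -factM mulVg fact1. Qed.

Lemma mem_fact g x s : (vact g x \in fact g s) = (x \in s).
Proof. by rewrite mem_imset //; apply: vact_inj. Qed.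

Lemma factU1 g x s : fact g (x |: s) = vact g x |: fact g s.
Proof. by rewrite /fact imsetU1. Qed.

Lemma card_vact g x : #|vact g x| = #|x|.
Proof. by rewrite card_imset //; apply: perm_inj. Qed.

Lemma card_fact g s : #|fact g s| = #|s|.
Proof. by rewrite card_imset //; apply: vact_inj. Qed.

(** The inversion count of [fsign] as a double sum, so that parities can be compared one pair of
    blocks at a time. *)
Definition inversions g s : nat :=
  \sum_(x in s) \sum_(y in s) (vlt x y && vlt (vact g y) (vact g x)).

Lemma fsignE g s : fsign g s = (-1) ^+ inversions g s.
Proof.
rewrite /fsign /inversions pair_big_dep /=; congr (_ ^+ _).
rewrite -sum1_card big_mkcond [RHS]big_mkcond /=; apply: eq_bigr => p _.
by rewrite inE; case: (p.1 \in s); case: (p.2 \in s) => //=; case: (_ && _).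
Qed.

Lemma fsignK g s : fsign g s * fsign g s = 1.
Proof. by rewrite fsignE -expr2 sqrr_sign. Qed.

Lemma sign_parity (a b c : nat) : (a = b + c.*2)%N -> (-1) ^+ a = (-1) ^+ b :> int.
Proof. by move=> ->; rewrite -signr_odd oddD odd_double addbF signr_odd. Qed.

Lemma fsignM g h s : fsign (g * h) s = fsign g s * fsign h (fact g s).
Proof.
rewrite !fsignE -exprD; symmetry.
(* [E] marks the pairs reversed by [g] and restored by [h]. They are counted once for [g] and once
   for [h] but not for the product, hence the even discrepancy. *)
pose E x y := vlt x y && vlt (vact g y) (vact g x)
              && vlt (vact h (vact g x)) (vact h (vact g y)).
apply: (@sign_parity _ _ (\sum_(x in s) \sum_(y in s) E x y)%N).
have -> : inversions h (fact g s) = (\sum_(x in s) \sum_(y in s)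
   (vlt (vact g x) (vact g y) && vlt (vact h (vact g y)) (vact h (vact g x))))%N.
  rewrite /inversions big_imset /=; last by move=> x y _ _ /vact_inj.
  by apply: eq_bigr => x _; rewrite big_imset //= => y z _ _ /vact_inj.
pose T x y := vlt (vact g x) (vact g y) && vlt (vact h (vact g y)) (vact h (vact g x)).
(* The inversions of [h] are ordered by their position after [g]; folding the sum onto pairs with
   [vlt x y] makes it comparable with the other two counts. *)
have -> : (\sum_(x in s) \sum_(y in s) T x y = \sum_(x in s) \sum_(y in s)
    ((vlt x y && T x y) + (vlt x y && T y x)))%N.
  transitivity (\sum_(x in s) \sum_(y in s) (vlt x y && T x y) +
                \sum_(x in s) \sum_(y in s) (vlt y x && T x y))%N.
    rewrite -big_split; apply: eq_bigr => x _; rewrite -big_split; apply: eq_bigr => y _ /=.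
    have [->|neq_xy] := eqVneq x y; first by rewrite /T !vlt_irr.
    by rewrite (vlt_total neq_xy); case: vlt; case: T.
  rewrite [X in (_ + X)%N]exchange_big -big_split.
  by apply: eq_bigr => x _; rewrite -big_split.
rewrite -addnn /inversions -!big_split /=.
apply: eq_bigr => x _; rewrite -!big_split /=; apply: eq_bigr => y _.
rewrite /E /T !vactM.
have [->|neq_xy] := eqVneq x y; first by rewrite !vlt_irr.
rewrite (@vlt_total (vact g x)) ?(inj_eq (@vact_inj g)) //.
rewrite (@vlt_total (vact h (vact g x))) ?(inj_eq (@vact_inj h)) ?(inj_eq (@vact_inj g)) //.
by case: (vlt x y); case: (vlt (vact g y) _); case: vlt.
Qed.

(** The sign identity behind equivariance of the boundary. The new inversions come from blocks that
    pass from after [x] to before it, or the other way round. The difference of these two counts is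
    the change in the rank of [x], and their sum has the same parity. *)
Lemma fsignU1 g x t : x \notin t ->
  fsign g (x |: t) * (-1) ^+ vrank (vact g x) (fact g (x |: t)) =
  fsign g t * (-1) ^+ vrank x (x |: t).
Proof.
move=> xt; rewrite factU1 !vrank_self ?mem_fact // !fsignE -!exprD.
apply: (@sign_parity _ _ (\sum_(y in t) (vlt x y && vlt (vact g y) (vact g x)))%N).
have inv_split : inversions g (x |: t) = (inversions g t +
  (\sum_(y in t) (vlt x y && vlt (vact g y) (vact g x)) +
   \sum_(y in t) (vlt y x && vlt (vact g x) (vact g y))))%N.
  rewrite /inversions big_setU1 //= big_setU1 //= vlt_irr add0n.
  rewrite addnCA; congr (_ + _)%N; rewrite addnC -big_split.
  by apply: eq_bigr => y _; rewrite big_setU1.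
have -> : vrank (vact g x) (fact g t) = (\sum_(y in t) vlt (vact g y) (vact g x))%N.
  by rewrite vrankE big_imset //= => y z _ _ /vact_inj.
rewrite inv_split vrankE -addnn -!addnA; congr (_ + _)%N; rewrite -!big_split /=.
apply: eq_bigr => y yt.
have neq_xy : x != y by apply: contraNneq xt => ->.
rewrite (vlt_total neq_xy) (@vlt_total (vact g x)) ?(inj_eq (@vact_inj g)) //.
by case: vlt; case: vlt.
Qed.

End Signs.

(** * Homology of the complex *)

Section Homology.
Variable n : nat.
Implicit Types (x y : {set 'I_n}) (s t : {set {set 'I_n}}) (f g z w : chain n).

Lemma isfaceP s :
  reflect ({in s, forall x, x != set0 /\ x != setT} /\
           {in s &, forall x y, x != y -> [disjoint x & y]}) (isface s).
Proof.
apply: (iffP andP) => [[/forall_inP p /forall_inP d]|[p d]]; split.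
- by move=> x /p /andP.
- by move=> x y xs ys; have /forall_inP/(_ y ys)/implyP := d x xs.
- by apply/forall_inP => x /p /andP.
- by apply/forall_inP => x xs; apply/forall_inP => y ys; apply/implyP; apply: d.
Qed.

Lemma isface_sub s t : t \subset s -> isface s -> isface t.
Proof.
move=> /subsetP ts /isfaceP[p d]; apply/isfaceP; split.
  by move=> x /ts /p.
by move=> x y /ts xs /ts ys; apply: d.
Qed.

Lemma isfaceU1 x t : x \notin t ->
  isface (x |: t) = [&& isface t, x != set0, x != setT & [disjoint x & cover t]].
Proof.
move=> xt; apply/idP/and4P => [face_xt | [/isfaceP[p d] x0 xT dx]].
  have /isfaceP[p d] := face_xt; have [x0 xT] := p x (setU11 _ _).
  split=> //; first by apply: isface_sub face_xt; apply: subsetU1.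
  apply: bigcup_disjoint => y yt.
  apply: d; rewrite ?setU11 ?setU1r //.
  by apply: contraNneq xt => ->.
have dxy y : y \in t -> [disjoint x & y].
  by move=> yt; apply: disjointWr dx; exact: (bigcup_max y).
apply/isfaceP; split=> [y /setU1P[->|/p]//|y y' /setU1P[->|yt] /setU1P[->|y't]]; last exact: d.
- by rewrite eqxx.
- by move=> _; apply: dxy.
- by rewrite disjoint_sym => _; apply: dxy.
Qed.

Lemma cover_sub s t : t \subset s -> cover t \subset cover s.
Proof.
move=> /subsetP ts; apply/bigcupsP => x /ts xs; exact: (bigcup_max x).
Qed.

Lemma face_block s x i : isface s -> x \in s -> i \in x -> [set i] \in s -> x = [set i].
Proof.
move=> /isfaceP[_ d] xs ix is_; apply/eqP; apply: contraTT ix => ne.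
by have := d _ _ xs is_ ne; rewrite disjoint_sym disjoints1.
Qed.

Lemma bdD f g : bd (f + g) = bd f + bd g.
Proof.
apply/ffunP => t; rewrite !ffunE -big_split; apply: eq_bigr => x _.
by rewrite ffunE mulrDr.
Qed.

Lemma bdN f : bd (- f) = - bd f.
Proof.
apply/ffunP => t; rewrite !ffunE -sumrN; apply: eq_bigr => x _.
by rewrite ffunE mulrN.
Qed.

Lemma bd0 : bd (0 : chain n) = 0.
Proof. by apply/ffunP => t; rewrite !ffunE big1 // => x _; rewrite ffunE mulr0. Qed.

(** The double boundary is a sum over ordered pairs of added blocks. Exchanging the two blocks
    changes the sign, because exactly one precedes the other; the sum is therefore its own negative,
    hence zero in the integers. *)
Lemma bd_bd f : bd (bd f) = 0.
Proof.
apply/ffunP => t; rewrite !ffunE.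
pose P x y := [&& x \notin t, y \notin t, x != y & isface (y |: (x |: t))].
pose F x y := (-1) ^+ (vrank x t + vrank y t + vlt x y) * f (y |: (x |: t)).
have -> : \sum_(x | (x \notin t) && isface (x |: t))
     (-1) ^+ vrank x (x |: t) * bd f (x |: t) = \sum_x \sum_(y | P x y) F x y.
  rewrite big_mkcond; apply: eq_bigr => x _.
  case: ifPn => [/andP[xt face_xt] | xt].
    rewrite ffunE mulr_sumr; apply: eq_big => y.
      by rewrite /P xt in_setU1 negb_or (eq_sym x) /= -andbA andbCA.
    rewrite in_setU1 negb_or => /andP[/andP[yx yt] _]; rewrite /F mulrA -exprD.
    by rewrite !vrank_self ?in_setU1 ?negb_or ?yx // vrankU1 // addnA addnAC.
  rewrite big1 // => y /and4P[xt' yt _ face_y].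
  case/negP: xt; rewrite xt' (isface_sub _ face_y) //; exact: subsetU1.
have PC x y : P x y = P y x.
  by rewrite /P setUCA (eq_sym x) andbCA.
have FC x y : P x y -> F x y = - F y x.
  case/and4P=> _ _ ne _; rewrite /F setUCA (addnC (vrank x t)) (vlt_total ne).
  by case: vlt => /=; rewrite ?addn0 ?addn1 ?exprS ?mulN1r ?mulNr ?opprK.
have : \sum_x \sum_(y | P x y) F x y = - \sum_x \sum_(y | P x y) F x y.
  rewrite -[RHS]sumrN.
  under eq_bigr do rewrite big_mkcond.
  rewrite exchange_big; apply: eq_bigr => x _ /=; rewrite -sumrN [RHS]big_mkcond.
  by apply: eq_bigr => y _; rewrite PC; case: ifP => // /FC ->; rewrite opprK.
lia.
Qed.

Lemma bd_neq0 f s : bd f s != 0 ->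
  exists x, [/\ x \notin s, isface (x |: s) & f (x |: s) != 0].
Proof.
rewrite ffunE => nz.
case: (pickP (fun x => [&& x \notin s, isface (x |: s) & f (x |: s) != 0])).
  by move=> x /and3P[]; exists x.
move=> no; case/eqP: nz; apply: big1 => x /andP[xs face_xs].
by have := no x; rewrite xs face_xs /= => /negbFE /eqP ->; rewrite mulr0.
Qed.

(** Indexed by the number of blocks rather than by dimension: [deg q] is the case [q.+1], and
    [m = 0] covers the augmentation degree of the empty face. *)
Definition chain_on (m : nat) f := forall s, f s != 0 -> isface s && (#|s| == m).

Lemma bd_chain_on m f : chain_on m.+1 f -> chain_on m (bd f).
Proof.
move=> hf s nz.
have [x [xs face_xs fx]] := bd_neq0 nz.
have /andP[_] := hf _ fx; rewrite cardsU1 xs eqSS => ->.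
by rewrite (isface_sub _ face_xs) ?subsetU1.
Qed.

(* The points at which a face can be toggled by a singleton block. *)
Definition loose s : {set 'I_n} := [set i | (i \notin cover s) || ([set i] \in s)].

(** If the singleton of [i] is a block of [s], no other block contains [i]; so in [t] either that
    singleton survives or [i] is uncovered. Hence adding blocks never creates loose points. *)
Lemma loose_sub s t : isface s -> t \subset s -> loose s \subset loose t.
Proof.
move=> face_s ts; apply/subsetP => i; rewrite !inE => /orP[ic|is_].
  by rewrite (contra (subsetP (cover_sub ts) i)).
have [it|it] := boolP ([set i] \in t); rewrite ?orbT ?orbF //.
apply/bigcupP => -[x xt ix]; case/negP: it.
by rewrite -(face_block face_s (subsetP ts x xt) ix is_).
Qed.

Definition loose_below (k : nat) s := [exists i : 'I_n, (i < k)%N && (i \in loose s)].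

Hypothesis n_gt1 : (1 < n)%N.

Lemma set1_proper (i : 'I_n) : [set i] != set0 /\ [set i] != setT.
Proof.
split; first by apply/set0Pn; exists i; rewrite inE.
by apply: contraTneq n_gt1 => e; rewrite -(card_ord n) -cardsT -e cards1.
Qed.

Lemma isface_set1U (k : 'I_n) s : [set k] \notin s ->
  isface ([set k] |: s) = isface s && (k \in loose s).
Proof.
move=> ks; have [k0 kT] := set1_proper k.
by rewrite isfaceU1 // k0 kT disjoints1 inE (negbTE ks) orbF.
Qed.

(* A contracting homotopy on the faces whose smallest loose point is [k]. *)
Definition toggle (k : 'I_n) f : chain n :=
  [ffun s => if [&& isface s, [set k] \in s & ~~ loose_below k s]
             then (-1) ^+ vrank [set k] s * f (s :\ [set k]) else 0].

Lemma toggle_chain_on m (k : 'I_n) f : chain_on m f -> chain_on m.+1 (toggle k f).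
Proof.
move=> hf s; rewrite ffunE; case: ifP => [/and3P[-> ks _]|]; last by rewrite eqxx.
by rewrite mulf_eq0 negb_or => /andP[_ /hf /andP[_]]; rewrite (cardsD1 [set k] s) ks.
Qed.

(** If the singleton of [k] is not in [s], only the coface obtained by adding it can contribute, and
    its two signs cancel. If it is in [s], the cycle condition on the face without it expresses
    [f s] through other cofaces, which match the terms on the left. *)
Lemma bd_toggle (k : 'I_n) f s :
  bd f = 0 -> (forall t, f t != 0 -> isface t /\ loose_below k.+1 t) ->
  ~~ loose_below k s -> bd (toggle k f) s = f s.
Proof.
move=> cyc hf not_lower.
have sub_lower t : isface t -> s \subset t -> ~~ loose_below k t.
  move=> ft st; apply: contra not_lower => /existsP[i /andP[ik it]].
  by apply/existsP; exists i; rewrite ik (subsetP (loose_sub ft st)).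
have loose_k t : f t != 0 -> ~~ loose_below k t -> k \in loose t.
  move=> /hf[_ /existsP[i /andP[]]]; rewrite ltnS leq_eqVlt => /orP[/eqP/val_inj->//|ik it].
  by case/existsP; exists i; rewrite ik.
have [face_s | /negP not_face] := boolP (isface s); last first.
  rewrite ffunE big1 => [|x /andP[_ face_xs]]; last first.
    by case: not_face; apply: isface_sub face_xs; apply: subsetU1.
  by have [->|/hf[]] := eqVneq (f s) 0.
have [ks | ks] := boolP ([set k] \in s); last first.
  (* If [k] is not loose, both sides vanish: [f s] by [loose_k], and the boundary because the
     singleton of [k] cannot be added to [s]. *)
  have [kl | kl] := boolP (k \in loose s); last first.
    have -> : f s = 0 by apply/eqP; apply: contraNT kl => /loose_k; apply.
    rewrite ffunE big1 // => x /andP[xs face_xs]; rewrite ffunE.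
    case: ifP => [/and3P[_]|_]; last by rewrite mulr0.
    rewrite in_setU1 (negbTE ks) orbF => /eqP kx.
    by move: kl face_xs; rewrite -kx isface_set1U // => /negbTE->; rewrite andbF.
  have face_ks : isface ([set k] |: s) by rewrite isface_set1U ?face_s.
  rewrite ffunE (bigD1 [set k]) ?ks //= big1 ?addr0; last first.
    move=> x /andP[/andP[xs _] xk]; rewrite ffunE in_setU1 (negbTE ks) eq_sym (negbTE xk).
    by rewrite andbF mulr0.
  rewrite ffunE face_ks setU11 sub_lower ?subsetU1 //= setU1K //.
  by rewrite mulrA -expr2 sqrr_sign mul1r.
set t := s :\ [set k].
have st : s = [set k] |: t by rewrite setD1K.
have kt : [set k] \notin t by rewrite !inE eqxx.
have kct : k \notin cover t.
  by move: face_s; rewrite st isfaceU1 // disjoints1 => /and4P[].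
(* Removing the singleton of [k] uncovers only [k], which was already loose in [s]. *)
have loose_t : loose t \subset loose s.
  apply/subsetP => i; rewrite st !inE => /orP[it|->]; last by rewrite !orbT.
  have [->|ik] := eqVneq i k; first by rewrite eqxx !orbT.
  by rewrite /cover big_setU1 //= !inE negb_or ik it.
(* Solve the cycle condition at [t] for the term of its coface [s], then compare with the boundary
   of [toggle k f] block by block. *)
have : bd f t = 0 by rewrite cyc ffunE.
rewrite ffunE (bigD1 [set k]) /=; last by rewrite kt -st.
rewrite -st => /eqP; rewrite addr_eq0 => /eqP sum_t.
rewrite -[f s]mul1r -(sqrr_sign _ (vrank [set k] s)) expr2 -mulrA sum_t.
have -> : vrank [set k] s = vrank [set k] t by rewrite st vrank_self.
rewrite mulrN ffunE mulr_sumr -sumrN.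
rewrite big_mkcond [RHS]big_mkcond; apply: eq_bigr => x _ /=.
have xsE : (x \notin s) = (x \notin t) && (x != [set k]).
  by rewrite st in_setU1 negb_or andbC.
rewrite andbAC -xsE; case: (boolP (x \notin s)) => //= xs.
have /andP[xt xk] : (x \notin t) && (x != [set k]) by rewrite -xsE.
have ts : t \subset s by apply: subD1set.
have [face_xs | nface_xs] := boolP (isface (x |: s)).
  rewrite (isface_sub _ face_xs) ?setUS // ffunE face_xs setU1r // sub_lower ?subsetU1 //=.
  have -> : vrank x (x |: s) = (vlt [set k] x + vrank x t)%N.
    by rewrite vrank_self // st vrankU1.
  have -> : vrank [set k] (x |: s) = (vlt x [set k] + vrank [set k] t)%N.
    by rewrite vrankU1 // st vrank_self.
  have -> : (x |: s) :\ [set k] = x |: t.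
    by rewrite st setUCA setU1K // in_setU1 negb_or eq_sym xk.
  (* Exactly one of [x] and the singleton of [k] precedes the other, which supplies the minus
     sign. *)
  rewrite vrank_self // !exprD (vlt_total xk).
  move: (_ ^+ vrank x t) (_ ^+ vrank [set k] t) (f _) => a b c.
  by case: vlt; rewrite /= expr0 expr1; ring.
(* Now [x] can be added to [t] but not to [s], so it contains [k]. Being different from the
   singleton of [k], it makes [k] covered and not loose in [x |: t], where [f] must then vanish. *)
case: ifP => // face_xt.
have -> : f (x |: t) = 0; last by rewrite !mulr0 oppr0.
have kx : k \in x.
  apply: contraNT nface_xs => kx; move: face_xt.
  rewrite !isfaceU1 // face_s => /and4P[_ -> -> dx].
  by rewrite st /cover big_setU1 //= -setI_eq0 setIUr setU_eq0 !setI_eq0 dx andbT disjoint_sym disjoints1.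
have lower : ~~ loose_below k (x |: t).
  apply: contra not_lower => /existsP[i /andP[ik il]]; apply/existsP; exists i.
  by rewrite ik (subsetP loose_t) // (subsetP (loose_sub face_xt (subsetU1 _ _))).
apply/eqP; apply/negPn/negP => /loose_k /(_ lower); rewrite inE.
by rewrite /cover big_setU1 //= in_setU kx /= in_setU1 eq_sym (negbTE xk) (negbTE kt).
Qed.

(** Induction on the bound: subtracting the boundary of the toggled chain removes the faces whose
    smallest loose point is [k]. The support condition on the primitive ensures that it does not
    disturb singleton-free facets in [cycle_extension]. *)
Lemma loose_acyclic k m f : chain_on m f -> bd f = 0 ->
    (forall s, f s != 0 -> loose_below k s) ->
  exists g, [/\ chain_on m.+1 g, f = bd g & forall s, g s != 0 -> exists i, [set i] \in s].
Proof.
elim: k f => [|k IH] f hf cyc low.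
  exists 0; split; try by move=> s; rewrite ffunE eqxx.
  rewrite bd0; apply/ffunP => s; rewrite ffunE; apply/eqP.
  by case: eqVneq => // /low /existsP[i /andP[]]; rewrite ltn0.
(* For [k] at least [n] there is no point [k] to toggle, and the smaller bound already holds. *)
have [kn | nk] := ltnP k n; last first.
  apply: IH => // s /low /existsP[i /andP[_ il]]; apply/existsP; exists i.
  by rewrite il (leq_trans (ltn_ord i)).
pose K := Ordinal kn; have ht := toggle_chain_on (k := K) hf.
have hw : chain_on m (f - bd (toggle K f)).
  move=> s; rewrite !ffunE; have [->|/hf//] := eqVneq (f s) 0.
  by rewrite add0r oppr_eq0 -/(bd (toggle K f) s) => nz; apply: (bd_chain_on ht); rewrite ffunE.
have [||g [hg fE gs]] := IH _ hw.
- by rewrite bdD bdN bd_bd subr0.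
- move=> s; apply: contraNT => /(bd_toggle (k := K) cyc) e; rewrite !ffunE.
  have := e _; rewrite ffunE => ->; first by rewrite subrr.
  by move=> t ft; split; [have /andP[] := hf _ ft | apply: low].
exists (g + toggle K f); split.
- by move=> s; rewrite ffunE; have [->|/hg//] := eqVneq (g s) 0; rewrite add0r; apply: ht.
- by rewrite bdD -fE subrK.
move=> s; rewrite ffunE; have [->|/gs//] := eqVneq (g s) 0; rewrite add0r ffunE.
by case: ifP => [/and3P[_ ks _]|]; rewrite ?eqxx //; exists K.
Qed.

(** * Facet coefficients of cycles *)

Lemma bd_facet f s : isfacet s -> bd f s = 0.
Proof.
case/andP=> _ /eqP cov; rewrite ffunE big1 // => x /andP[xs].
rewrite isfaceU1 // -[cover s]/(\bigcup_(x in s) x) cov => /and4P[_ /set0Pn[i ix] _].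
by move/disjointFr => /(_ i ix); rewrite inE.
Qed.

(** A face that is not a facet leaves some point uncovered, hence loose, so [loose_acyclic] applies
    to the whole support. *)
Lemma cycle_off_facets q z :
  zcycle q z -> (forall s, isfacet s -> z s = 0) -> boundary q z.
Proof.
case=> hz cyc nf; have [|g [hg zE _]] := loose_acyclic (k := n) hz cyc; last by exists g.
move=> s zs; have /andP[face_s _] := hz _ zs.
have : cover s != setT.
  by apply: contraNneq zs => cov; rewrite nf // /isfacet face_s; apply/eqP.
rewrite -subTset => /subsetPn[i _ ic]; apply/existsP; exists i.
by rewrite ltn_ord inE ic.
Qed.

(** Without its singleton block the facet leaves only [i] uncovered, so [s] is the only coface of
    what remains; the cycle condition there has a single term. *)
Lemma cycle_singleton q z s i : zcycle q z -> isfacet s -> [set i] \in s -> z s = 0.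
Proof.
case=> hz cyc /andP[face_s /eqP cov] is_.
pose t := s :\ [set i]; have st : s = [set i] |: t by rewrite setD1K.
have it : [set i] \notin t by rewrite !inE eqxx.
have : bd z t = 0 by rewrite cyc ffunE.
rewrite ffunE (bigD1 [set i]) /=; last by rewrite it -st.
rewrite -st big1 ?addr0 => [/eqP|x /andP[/andP[xt face_xt] xi]].
  by rewrite mulf_eq0 signr_eq0 => /eqP.
case/negP: xi.
have := face_xt; rewrite isfaceU1 // => /and4P[_ x0 _ dx].
suff : x \subset [set i] by rewrite subset1 (negbTE x0) orbF.
apply/subsetP => j jx; have : j \in cover s by rewrite /cover cov inE.
rewrite /cover st big_setU1 //= in_setU => /orP[//|].
by rewrite (disjointFr dx jx).
Qed.

(** Every face in the support of [bd f] has an uncovered point, so [bd f] bounds a chain [g]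
    supported on faces with a singleton block, and [f - g] is the required cycle. On facets with a
    singleton, [f] and the cycle both vanish. *)
Lemma cycle_extension q f : deg q f ->
    (forall s, f s != 0 -> isfacet s /\ forall i, [set i] \notin s) ->
  exists2 z, zcycle q z & forall s, isfacet s -> z s = f s.
Proof.
move=> hf ns; have hbf := bd_chain_on hf.
have [|g [hg bdE gs]] := loose_acyclic (k := n) hbf (bd_bd f).
  move=> s nz; have [x [xs face_xs _]] := bd_neq0 nz.
  move: face_xs; rewrite isfaceU1 // => /and4P[_ /set0Pn[i ix] _ dx].
  by apply/existsP; exists i; rewrite ltn_ord inE (disjointFr dx ix).
have cyc : zcycle q (f - g).
  split; last by rewrite bdD bdN bdE subrr.
  move=> s; rewrite !ffunE; have [->|/hf//] := eqVneq (f s) 0.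
  by rewrite add0r oppr_eq0 => /hg.
exists (f - g) => // s fs.
have [/existsP[i is_]|/existsPn no] := boolP [exists i : 'I_n, [set i] \in s].
  rewrite (cycle_singleton cyc fs is_); apply/esym/eqP.
  by apply: contraTT is_ => /ns[_ /(_ i)].
rewrite !ffunE; have [->|/gs[i is_]] := eqVneq (g s) 0; first by rewrite subr0.
by have := no i; rewrite is_.
Qed.
End Homology.

(** * Equivariance and stabilisers *)

Section Equivariance.
Variable n : nat.
Implicit Types (x y : {set 'I_n}) (s t : {set {set 'I_n}}) (f z : chain n) (g h : 'S_n).

Lemma disjoint_vact g x y : [disjoint vact g x & vact g y] = [disjoint x & y].
Proof.
rewrite -!setI_eq0 -[in LHS]imsetI; last by move=> i j _ _ /perm_inj.
by rewrite imset_eq0.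
Qed.

Lemma isface_fact g s : isface (fact g s) = isface s.
Proof.
suff imp h t : isface t -> isface (fact h t).
  by apply/idP/idP => [/(imp g^-1%g)|/imp //]; rewrite factK.
move=> /isfaceP[p d]; apply/isfaceP; split.
  move=> _ /imsetP[x /p[x0 xT] ->]; split; first by rewrite imset_eq0.
  apply: contraNneq xT => e; apply/eqP/setP => i; rewrite inE.
  by have := in_setT (h i); rewrite -e mem_imset //; apply: perm_inj.
move=> _ _ /imsetP[x xt ->] /imsetP[y yt ->] ne; rewrite disjoint_vact.
by apply: d => //; apply: contraNneq ne => ->.
Qed.

Lemma cover_fact g s : cover (fact g s) = vact g (cover s).
Proof.
rewrite cover_imset /cover /vact; apply/setP => i.
apply/bigcupP/imsetP => [[x xs /imsetP[j jx ->]]|[j /bigcupP[x xs jx] ->]].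
  by exists j => //; apply/bigcupP; exists x.
by exists x => //; apply: imset_f.
Qed.

Lemma isfacet_fact g s : isfacet (fact g s) = isfacet s.
Proof.
rewrite /isfacet isface_fact -!/(cover _) cover_fact; congr (_ && _).
rewrite !eqEcard !subsetT /= cardsT card_ord.
by rewrite card_vact.
Qed.

Lemma sizes_fact g s :
  perm_eq [seq #|x| | x : {set 'I_n} <- enum (fact g s)] [seq #|x| | x : {set 'I_n} <- enum s].
Proof.
have: perm_eq (enum (fact g s)) (map (vact g) (enum s)).
  apply: uniq_perm; rewrite ?enum_uniq ?map_inj_uniq ?enum_uniq //; first exact: vact_inj.
  move=> x; rewrite mem_enum; apply/imsetP/mapP => -[y ys ->]; exists y => //.
    by rewrite mem_enum.
  by rewrite mem_enum in ys.
move/(perm_map (fun x : {set 'I_n} => #|x|)) => /perm_trans; apply.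
by rewrite -map_comp (eq_map (card_vact g)).
Qed.

Lemma facet_of_shape_fact g lam s : facet_of_shape lam (fact g s) = facet_of_shape lam s.
Proof. by rewrite /facet_of_shape isfacet_fact (permPl (sizes_fact g s)). Qed.

Lemma bd_cact g f : bd (cact g f) = cact g (bd f).
Proof.
apply/ffunP => t; rewrite -[t](factVK g); move: (fact _ t) => {}t.
rewrite !ffunE factK mulr_sumr (reindex_inj (@vact_inj n g)) /=.
apply: eq_big => x; first by rewrite mem_fact -factU1 isface_fact.
rewrite mem_fact => /andP[xt _].
rewrite ffunE -factU1 factK !mulrA; congr (_ * _).
by rewrite mulrC fsignU1.
Qed.

Lemma cact_deg q g f : deg q f -> deg q (cact g f).
Proof.
move=> hf t; rewrite ffunE mulf_eq0 negb_or => /andP[_ /hf].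
by rewrite isface_fact card_fact.
Qed.

Lemma zcycle_cact q g z : zcycle q z -> zcycle q (cact g z).
Proof.
case=> dz cyc; split; first exact: cact_deg.
by rewrite bd_cact cyc; apply/ffunP => t; rewrite !ffunE mulr0.
Qed.

Lemma Vlam_cact q lam g z : Vlam q lam z -> Vlam q lam (cact g z).
Proof.
case=> cyc shape; split; first exact: zcycle_cact.
move=> s fs; rewrite ffunE mulf_eq0 negb_or => /andP[_ /shape].
by rewrite isfacet_fact facet_of_shape_fact; apply.
Qed.

(** * The normaliser of a Young subgroup as the stabiliser of a facet *)

Section Stabiliser.
Variable s : {set {set 'I_n}}.
Hypothesis facet_s : isfacet s.

Let young_of := [set g : 'S_n | [forall x in s, vact g x == x]].

Lemma facet_block_ex i : exists2 x, x \in s & i \in x.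
Proof.
case/andP: facet_s => _ /eqP cov; have : i \in cover s by rewrite /cover cov inE.
by case/bigcupP=> x xs ix; exists x.
Qed.

Lemma facet_block_eq x y i : x \in s -> y \in s -> i \in x -> i \in y -> x = y.
Proof.
case/andP: facet_s => /isfaceP[_ d] _ xs ys ix iy; apply/eqP; apply: contraTT ix => ne.
by rewrite (disjointFl (d _ _ xs ys ne)).
Qed.

(** Recovers the blocks from the group, through the transpositions it contains. *)
Lemma tperm_young i j x : x \in s -> i \in x -> (tperm i j \in young_of) = (j \in x).
Proof.
move=> xs ix; rewrite inE; apply/forall_inP/idP => [fix_|jx y ys].
  by have /eqP <- := fix_ x xs; rewrite -{1}(tpermL i j); apply: imset_f.
have ij : (i \in y) = (j \in y).
  by apply/idP/idP => iy; rewrite ?(facet_block_eq ys xs iy ix) ?(facet_block_eq ys xs iy jx).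
apply/eqP/setP => k; rewrite -{1}(tpermK i j k) mem_imset; last exact: perm_inj.
by case: tpermP => // ->.
Qed.

(** Conjugation by [g] turns the transposition of [i] and [j] into that of their images. A
    normalising [g] thus preserves the relation of lying in a common block, and so permutes the
    blocks. *)
Lemma norm_young g : (g \in 'N(young_of))%g = (fact g s == s).
Proof.
apply/idP/eqP => [ng | gs].
  apply/eqP; rewrite eqEcard card_fact leqnn andbT; apply/subsetP => _ /imsetP[x xs ->].
  case/andP: (facet_s) => /isfaceP[/(_ x xs)[/set0Pn[i ix] _] _] _.
  have [y ys gy] := facet_block_ex (g i).
  suff -> : vact g x = y by [].
  apply/setP => j; rewrite -{1}(permKV g j) mem_imset; last exact: perm_inj.
  by rewrite -(tperm_young _ xs ix) -(memJ_norm _ ng) tpermJ permKV (tperm_young _ ys gy).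
rewrite inE; apply/subsetP => _ /imsetP[h yh ->].
move: yh; rewrite !inE => /forall_inP hs.
apply/forall_inP => x xs.
have : vact g^-1 x \in s by rewrite -(mem_fact g) vactVK gs.
by move=> /hs /eqP e; rewrite /conjg !vactM e vactVK.
Qed.
End Stabiliser.

End Equivariance.

(** * Facets of a fixed shape *)

Lemma card_ord_interval n a b : (b <= n)%N -> #|[set j : 'I_n | (a <= j < b)%N]| = (b - a)%N.
Proof.
move=> bn; rewrite -sum1_card (eq_bigl (fun j : 'I_n => (a <= j < b)%N)); last first.
  by move=> j; rewrite inE.
rewrite -(big_mkord (fun j => (a <= j < b)%N) (fun=> 1%N)).
have [ab|ba] := leqP a b; last by rewrite big1_seq //; lia.
rewrite (big_cat_nat _ (n := a)) //=; last lia.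
rewrite (big_cat_nat _ (m := a) (n := b)) //=.
rewrite big1_seq; last by move=> j; rewrite mem_index_iota; lia.
rewrite add0n [X in (_ + X)%N]big1_seq; last by move=> j; rewrite mem_index_iota; lia.
rewrite addn0 big_nat_cond (eq_bigl (fun j => (a <= j < b)%N)); last by move=> j; rewrite andbb.
by rewrite -big_nat sum_nat_const_nat muln1.
Qed.

Lemma sumn_take_le (lam : seq nat) i j : (i <= j)%N -> (sumn (take i lam) <= sumn (take j lam))%N.
Proof.
move=> ij; rewrite -(subnKC ij) takeD sumn_cat; exact: leq_addr.
Qed.

Lemma sumn_takeS (lam : seq nat) i : (i < size lam)%N ->
  sumn (take i.+1 lam) = (sumn (take i lam) + nth 0%N lam i)%N.
Proof. by move=> il; rewrite (take_nth 0%N il) sumn_rcons. Qed.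

Lemma geq_trans : transitive geq.
Proof. by move=> b a c /= ba cb; apply: leq_trans cb ba. Qed.

Lemma lexlt_lt (s t : seq nat) : s != [::] -> t != [::] ->
  {in s & t, forall a b, (a < b)%N} -> lexlt s t.
Proof. by case: s => // a s; case: t => //= b t _ _ /(_ a b) ->; rewrite ?mem_head. Qed.

Section Shape.
Variables (n q : nat) (lam : seq nat).
Hypothesis lam_valid : valid_shape n q lam.
Implicit Types (s t : {set {set 'I_n}}) (z : chain n) (g h : 'S_n).

Let size_lam : size lam = q.+1. Proof. by case/and4P: lam_valid => _ _ /eqP. Qed.
Let sum_lam : sumn lam = n. Proof. by case/and4P: lam_valid => _ /eqP. Qed.
Let sort_lam : sorted geq lam. Proof. by case/and4P: lam_valid. Qed.

Definition min_face : {set {set 'I_n}} := [set blk n lam i | i : 'I_(size lam)].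

Lemma take_bound i : (sumn (take i lam) <= n)%N.
Proof. by rewrite -sum_lam -{2}(cat_take_drop i lam) sumn_cat leq_addr. Qed.

Lemma card_blk i : (i < size lam)%N -> #|blk n lam i| = nth 0%N lam i.
Proof.
by move=> il; rewrite card_ord_interval ?take_bound // sumn_takeS // addKn.
Qed.

Lemma card_blk_bounds i : (i < size lam)%N -> (1 < #|blk n lam i| < n)%N.
Proof.
move=> il; rewrite card_blk //; case/and4P: lam_valid => _ _ _ /allP; apply.
exact: mem_nth.
Qed.

Lemma mem_blk_lt i j (a b : 'I_n) : (i < j)%N -> a \in blk n lam i -> b \in blk n lam j ->
  (a < b)%N.
Proof.
move=> /(sumn_take_le lam) ij; rewrite !inE => /andP[_ ha] /andP[hb _].
exact: leq_trans ha (leq_trans ij hb).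
Qed.

Lemma mem_blk_ex (a : 'I_n) : exists i : 'I_(size lam), a \in blk n lam i.
Proof.
suff ex k : (k <= size lam)%N -> (a < sumn (take k lam))%N ->
    exists i : 'I_(size lam), a \in blk n lam i.
  by apply: (ex (size lam)) => //; rewrite take_size sum_lam.
elim: k => [|k IH] kl; first by rewrite take0.
have [/(IH (ltnW kl))//|ka] := ltnP a (sumn (take k lam)).
by move=> ak; exists (Ordinal kl); rewrite inE ka.
Qed.

(** Block sizes weakly decrease, and blocks of equal size are separated lexicographically by their
    first elements, since they are successive intervals. *)
Lemma vlt_blk_lt i j : (i < j)%N -> (j < size lam)%N -> vlt (blk n lam i) (blk n lam j).
Proof.
move=> ij jl; have il := ltn_trans ij jl; rewrite /vlt.
have : (#|blk n lam j| <= #|blk n lam i|)%N.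
  rewrite !card_blk //.
  exact: (sorted_ltn_nth geq_trans 0%N sort_lam).
rewrite leq_eqVlt => /orP[/eqP->|->//]; rewrite eqxx ltnn.
have nonempty k : (k < size lam)%N -> [seq val i | i <- enum (blk n lam k)] != [::].
  move=> /card_blk_bounds; rewrite cardE; by case: (enum _).
apply: lexlt_lt; try exact: nonempty.
move=> _ _ /mapP[a + ->] /mapP[b + ->]; rewrite !mem_enum; exact: mem_blk_lt.
Qed.

Lemma vlt_blk i j : (i < size lam)%N -> (j < size lam)%N ->
  vlt (blk n lam i) (blk n lam j) = (i < j)%N.
Proof.
move=> il jl; case: ltngtP => [ij|ji|->]; last exact: vlt_irr.
- exact: vlt_blk_lt.
- by apply: vlt_asym; apply: vlt_blk_lt.
Qed.

Lemma blk_inj i j : (i < size lam)%N -> (j < size lam)%N -> blk n lam i = blk n lam j -> i = j.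
Proof.
move=> il jl e; have := vlt_blk il jl; have := vlt_blk jl il; rewrite e vlt_irr.
lia.
Qed.

Lemma enum_min_face : perm_eq (enum min_face) [seq blk n lam i | i <- iota 0 (size lam)].
Proof.
apply: uniq_perm; rewrite ?enum_uniq ?map_inj_in_uniq ?iota_uniq //.
  by move=> i j; rewrite !mem_iota; apply: blk_inj.
move=> x; rewrite mem_enum; apply/imsetP/mapP => [[i _ ->]|[i + ->]].
  by exists (val i); rewrite ?mem_iota /=.
by rewrite mem_iota /= => il; exists (Ordinal il).
Qed.

Lemma min_face_shape : facet_of_shape lam min_face.
Proof.
rewrite /facet_of_shape -andbA; apply/and3P; split.
- apply/isfaceP; split=> [_ /imsetP[i _ ->]|_ _ /imsetP[i _ ->] /imsetP[j _ ->] ne].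
    have /andP[c1 cn] := card_blk_bounds (ltn_ord i); split.
      by rewrite -card_gt0 ltnW.
    by apply: contraTneq cn => ->; rewrite cardsT card_ord ltnn.
  have ij : i != j :> nat by apply: contraNneq ne => ->.
  apply/pred0P => a; apply/negP => /andP[/= ai aj].
  case: (ltngtP i j) ij => // ij _.
    by have := mem_blk_lt ij ai aj; rewrite ltnn.
  by have := mem_blk_lt ij aj ai; rewrite ltnn.
- rewrite -subTset; apply/subsetP => a _; have [i ai] := mem_blk_ex a.
  by apply/bigcupP; exists (blk n lam i) => //; apply: imset_f.
apply: perm_trans (perm_map _ enum_min_face) _.
suff -> : map (fun x : {set 'I_n} => #|x|) [seq blk n lam i | i <- iota 0 (size lam)] = lam by [].
rewrite -map_comp -[RHS](mkseq_nth 0%N); apply/eq_in_map => i.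
by rewrite mem_iota; apply: card_blk.
Qed.

Lemma shape_transitive t : facet_of_shape lam t -> exists g, fact g min_face = t.
Proof.
move=> /andP[facet_t perm_t].
pose bs := sort (relpre (fun x : {set 'I_n} => #|x|) geq) (enum t).
have bs_size : [seq #|x| | x : {set 'I_n} <- bs] = lam.
  apply: (@sorted_eq _ geq) => //.
  - exact: geq_trans.
  - by move=> a b /=; rewrite andbC -eqn_leq => /eqP.
  - rewrite sorted_map; apply: sort_sorted => x y /=; exact: leq_total.
  - apply: perm_trans perm_t; apply: perm_map; exact/permPl/perm_sort.
have mem_bs x : (x \in bs) = (x \in t) by rewrite mem_sort mem_enum.
have sz : size bs = size lam by rewrite -bs_size size_map.
(* [L] lists the points block by block, in decreasing size. Sending position [i] to the [i]-th entry
   carries the successive intervals of [min_face] onto the blocks of [t]. *)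
pose L := flatten (map (fun x : {set 'I_n} => enum x) bs).
have szL m : size (flatten (map (fun x : {set 'I_n} => enum x) (take m bs))) = sumn (take m lam).
  rewrite size_flatten /shape -map_comp -bs_size -map_take; congr sumn.
  by apply: eq_map => x; rewrite /= cardE.
have memL a : a \in L.
  have [x xt ax] := facet_block_ex facet_t a.
  apply/flattenP; exists (enum x); rewrite ?mem_enum //; apply: map_f.
  by rewrite mem_bs.
have sizeL : size L = n.
  by have := szL (size bs); rewrite take_size sz take_size sum_lam.
(* [L] contains all [n] points and has length [n], so nothing repeats. *)
have uniqL : uniq L.
  rewrite (leq_size_uniq (enum_uniq 'I_n)) //.
  by rewrite -cardE card_ord sizeL.
pose f (i : 'I_n) := nth i L i.
have f_inj : injective f.
  move=> i j /eqP; rewrite /f (set_nth_default j) ?sizeL // nth_uniq ?sizeL //.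
  by move/eqP/val_inj.
exists (perm f_inj).
suff blkE i : (i < size lam)%N -> vact (perm f_inj) (blk n lam i) = nth set0 bs i.
  apply/setP => x; rewrite -mem_bs; apply/imsetP/idP => [[_ /imsetP[i _ ->] ->]|xb].
    by rewrite blkE ?mem_nth ?sz.
  have il : (index x bs < size lam)%N by rewrite -sz index_mem.
  exists (blk n lam (index x bs)); last by rewrite blkE // nth_index.
  exact: (imset_f _ (x := Ordinal il)).
move=> il.
have card_i : #|nth set0 bs i| = nth 0%N lam i.
  by rewrite -(nth_map set0 0%N (fun x : {set 'I_n} => #|x|)) ?sz // bs_size.
apply/eqP; rewrite eqEcard card_vact card_blk // card_i leqnn andbT.
apply/subsetP => _ /imsetP[a + ->]; rewrite inE permE /f.
rewrite sumn_takeS // => /andP[la ua].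
have split_bs : bs = take i bs ++ nth set0 bs i :: drop i.+1 bs.
  by rewrite -drop_nth ?sz // cat_take_drop.
(* The first [i] blocks fill the positions before [sumn (take i lam)], so position [a] falls in the
   segment listing block [i]. *)
rewrite /L {1}split_bs map_cat flatten_cat nth_cat szL ltnNge la /= nth_cat.
have -> : (a - sumn (take i lam) < size (enum (nth set0 bs i)))%N.
  by rewrite -cardE card_i; lia.
rewrite -mem_enum; apply: mem_nth.
by rewrite -cardE card_i; lia.
Qed.
Lemma min_face_facet : isfacet min_face.
Proof. by case/andP: min_face_shape. Qed.

(** * Coefficients of one shape as an induced module *)

Lemma mem_Nlam g : (g \in Nlam n lam) = (fact g min_face == min_face).
Proof.
rewrite -(norm_young min_face_facet) /Nlam; congr (_ \in 'N(_))%g.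
apply/setP => h; rewrite !inE; apply/allP/forall_inP => [fix_ _ /imsetP[i _ ->]|fix_ i].
  by apply: fix_; rewrite mem_iota /=.
rewrite mem_iota /= => il; apply: fix_; exact: (imset_f _ (x := Ordinal il)).
Qed.

Lemma gbarP g i j : (i < size lam)%N -> (j < size lam)%N ->
  vact g (blk n lam i) = blk n lam j -> gbar lam g i = j.
Proof.
move=> il jl e; rewrite /gbar; set p := fun k => _.
have has_p : has p (iota 0 (size lam)).
  by apply/hasP; exists j; rewrite ?mem_iota //= /p e.
have kl : (find p (iota 0 (size lam)) < size lam)%N by rewrite -{2}(size_iota 0 (size lam)) -has_find.
have := nth_find 0%N has_p; rewrite nth_iota // add0n => /eqP found.
by apply: (blk_inj kl jl); rewrite -found.
Qed.

(** By [vlt_blk] the indexing of the blocks respects the vertex order, so inversions of [gbar] on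
    indices are inversions of [k] on blocks. *)
Lemma epsE k : k \in Nlam n lam -> eps lam k = fsign k min_face.
Proof.
rewrite mem_Nlam => /eqP fix_k; rewrite fsignE /eps /inversions; congr (_ ^+ _).
have blk_ord : injective (fun i : 'I_(size lam) => blk n lam i).
  by move=> i j /blk_inj e; apply/val_inj/e.
rewrite big_imset /=; last by move=> i j _ _ /blk_ord.
apply: eq_bigr => i _; rewrite big_imset /=; last by move=> a b _ _ /blk_ord.
have vactE (a : 'I_(size lam)) : exists2 b, (b < size lam)%N & vact k (blk n lam a) = blk n lam b.
  have : vact k (blk n lam a) \in min_face by rewrite -fix_k mem_fact; apply: imset_f.
  by case/imsetP => b _ ->; exists b.
apply: eq_bigr => j _; have [[a al ea] [b bl eb]] := (vactE i, vactE j).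
by rewrite (gbarP _ al ea) // (gbarP _ bl eb) // ea eb !vlt_blk.
Qed.

Definition shape_map z : {ffun 'S_n -> int} :=
  [ffun g => fsign g min_face * z (fact g min_face)].

Lemma shape_map_indmod z : indmod lam (shape_map z).
Proof.
move=> k g kN; rewrite !ffunE (epsE kN) fsignM factM.
by move: kN; rewrite mem_Nlam => /eqP ->; rewrite mulrA.
Qed.

Lemma shape_mapD z1 z2 : shape_map (z1 + z2) = shape_map z1 + shape_map z2.
Proof. by apply/ffunP => g; rewrite !ffunE mulrDr. Qed.

Lemma shape_map_act g z : shape_map (cact g z) = indact g (shape_map z).
Proof.
apply/ffunP => y; rewrite !ffunE -factM -{1}(mulgKV g y) fsignM.
by rewrite -!mulrA (mulrA (fsign g _)) fsignK mul1r.
Qed.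

Lemma shape_map_eq0 z :
  shape_map z = 0 <-> (forall t, facet_of_shape lam t -> z t = 0).
Proof.
split=> [e t /shape_transitive[g <-]|z0].
  move/ffunP/(_ g): e; rewrite !ffunE => /(congr1 ( *%R (fsign g min_face))).
  by rewrite mulrA fsignK mul1r mulr0.
by apply/ffunP => g; rewrite !ffunE z0 ?mulr0 // facet_of_shape_fact min_face_shape.
Qed.

Lemma shape_no_singleton t i : facet_of_shape lam t -> [set i] \notin t.
Proof.
move=> /andP[_ perm_t]; apply/negP => it.
have : 1%N \in lam by rewrite -(perm_mem perm_t); apply/mapP; exists [set i]; rewrite ?mem_enum ?cards1.
by case/and4P: lam_valid => _ _ _ /allP/[apply].
Qed.

Lemma shape_card t : facet_of_shape lam t -> #|t| = q.+1.
Proof. by case/andP=> _ /perm_size; rewrite size_map size_lam cardE. Qed.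

Lemma shape_map_surj F : (1 < n)%N -> indmod lam F -> exists2 z, Vlam q lam z & shape_map z = F.
Proof.
move=> n_gt1 indF.
(* The formula of [shape_map] solved for the coefficient at [t], using an arbitrary [g] that carries
   the minimal face to [t]. *)
pose f : chain n :=
  [ffun t => if [pick g | fact g min_face == t] is Some g then fsign g min_face * F g else 0].
have f_shape t : f t != 0 -> facet_of_shape lam t.
  rewrite ffunE; case: pickP => [g /eqP <- _|]; last by rewrite eqxx.
  by rewrite facet_of_shape_fact min_face_shape.
have [||z cyc zf] := @cycle_extension n n_gt1 q f.
- move=> t /f_shape ft; rewrite (shape_card ft) eqxx andbT.
  by case/andP: ft => /andP[].
- move=> t /f_shape ft; split; first by case/andP: ft.
  by move=> i; apply: shape_no_singleton.
exists z; first by split=> // s fs; rewrite zf //; apply: f_shape.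
apply/ffunP => g; rewrite ffunE zf ?isfacet_fact ?min_face_facet // ffunE.
case: pickP => [h /eqP gh|/(_ g)]; last by rewrite eqxx.
(* The chosen [h] and the given [g] differ by an element of the normaliser; the equivariance of [F]
   contributes [eps], which cancels the change of orientation. *)
have kN : (h * g^-1)%g \in Nlam n lam by rewrite mem_Nlam factM gh factK.
rewrite -(mulgKV g h) indF // (epsE kN) fsignM.
have -> : fact (h * g^-1) min_face = min_face by apply/eqP; rewrite -mem_Nlam.
have signK k a : fsign k min_face * (fsign k min_face * a) = a by rewrite mulrA fsignK mul1r.
by rewrite (mulrC (fsign (h * g^-1) _) (fsign g _)) -(mulrA (fsign g _)) !signK.
Qed.
End Shape.

(** * The induced modules *)

Section DirectSum.
Variables n q : nat.
Hypothesis n_gt1 : (1 < n)%N.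
Implicit Types (s : {set {set 'I_n}}) (z : chain n).

Lemma zcycle_sum I (r : seq I) (z : I -> chain n) :
  (forall i, zcycle q (z i)) -> zcycle q (\sum_(i <- r) z i).
Proof.
move=> cyc; elim/big_rec: _ => [|i y _ [dy cy]].
  by split=> [s|]; rewrite ?ffunE ?eqxx // bd0.
have [dz cz] := cyc i; split; last by rewrite bdD cz cy addr0.
by move=> s; rewrite ffunE; have [->|/dz//] := eqVneq (z i s) 0; rewrite add0r; apply: dy.
Qed.

Lemma facet_shape_ex s : isfacet s -> #|s| = q.+1 -> (forall i, [set i] \notin s) ->
  exists t : q.+1.-tuple 'I_n,
    valid_shape n q [seq val i | i <- t] /\ facet_of_shape [seq val i | i <- t] s.
Proof.
move=> facet_s card_s no1; have /andP[/isfaceP[proper disj] /eqP cov] := facet_s.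
pose lam := sort geq [seq #|x| | x : {set 'I_n} <- enum s].
have perm_lam : perm_eq [seq #|x| | x : {set 'I_n} <- enum s] lam.
  by rewrite perm_sym; apply/permPl/perm_sort.
have size_lam : size lam = q.+1 by rewrite -(perm_size perm_lam) size_map -cardE.
have lam_bounds : all (fun a => (1 < a < n)%N) lam.
  rewrite -(perm_all _ perm_lam); apply/allP => _ /mapP[x + ->]; rewrite mem_enum => xs.
  have [x0 xT] := proper x xs; apply/andP; split.
    rewrite ltn_neqAle card_gt0 x0 andbT eq_sym.
    by apply/cards1P => -[i xi]; have := no1 i; rewrite -xi xs.
  by rewrite -[X in (_ < X)%N](card_ord n) -cardsT proper_card // properT.
(* All parts are below [n], so the default of [insubd] is never taken. *)
pose t := [seq insubd (Ordinal n_gt1) m | m <- lam].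
have valt : [seq val i | i <- t] = lam.
  rewrite -map_comp -[RHS]map_id; apply/eq_in_map => m /(allP lam_bounds)/andP[_ mn] /=.
  by rewrite val_insubd mn.
have t_size : size t == q.+1 by rewrite size_map size_lam.
exists (Tuple t_size); rewrite /= valt; split; last by rewrite /facet_of_shape facet_s.
rewrite /valid_shape size_lam eqxx lam_bounds !andbT; apply/andP; split.
  by apply: sort_sorted => a b /=; apply: leq_total.
rewrite -(perm_sumn perm_lam) sumnE big_map big_enum /=.
have /eqP -> : trivIset s by apply/trivIsetP => x y xs ys; apply: disj.
by rewrite /cover cov cardsT card_ord.
Qed.

Lemma shape_unique lam mu s : valid_shape n q lam -> valid_shape n q mu ->
  facet_of_shape lam s -> facet_of_shape mu s -> lam = mu.
Proof.
move=> /andP[sl _] /andP[sm _] /andP[_ pl] /andP[_ pm].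
apply: (sorted_eq geq_trans _ sl sm); last by rewrite -(permPl pl).
by move=> a b /=; rewrite andbC -eqn_leq => /eqP.
Qed.

Lemma boundary_facet z s : boundary q z -> isfacet s -> z s = 0.
Proof. by case=> g [_ ->]; apply: bd_facet. Qed.

Lemma Vlam_iso lam : valid_shape n q lam ->
  ZSn_iso (@Vlam n q lam) (@boundary n q) (@indmod n lam) (@indact n).
Proof.
move=> lam_valid; exists (@shape_map n lam); split.
- by move=> z _; apply: shape_map_indmod lam_valid _.
- by move=> z1 z2 _ _; apply: shape_mapD.
- move=> z [cyc shape]; split.
    move/(shape_map_eq0 lam_valid) => z0; apply: cycle_off_facets => // s fs.
    by have [//|nz] := eqVneq (z s) 0; apply: z0 (shape s fs nz).
  move=> bz; apply/(shape_map_eq0 lam_valid) => t /andP[ft _]; exact: boundary_facet.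
- by move=> F indF; apply: shape_map_surj lam_valid _ n_gt1 indF.
by move=> g z _; apply: shape_map_act.
Qed.

Lemma homology_iso :
  ZSn_iso (@zcycle n q) (@boundary n q) (@summod n q) (@sumact n q).
Proof.
pose shape (t : q.+1.-tuple 'I_n) := [seq val i | i <- t].
pose phi z := [ffun t => if valid_shape n q (shape t) then shape_map (shape t) z else 0].
exists phi; split.
- move=> z _ t; rewrite ffunE -/(shape t); case vt: (valid_shape n q (shape t)) => //.
  exact: shape_map_indmod vt _.
- move=> z1 z2 _ _; apply/ffunP => t; rewrite !ffunE; case: ifP => _; last by rewrite addr0.
  exact: shape_mapD.
- move=> z cyc; split=> [z0|bz]; last first.
    apply/ffunP => t; rewrite !ffunE; case: ifP => // vt.
    by apply/(shape_map_eq0 vt) => s /andP[fs _]; apply: boundary_facet.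
  (* A facet with nonzero coefficient in a cycle has no singleton block, so its shape is one of the
     summands and the corresponding component detects it. *)
  apply: cycle_off_facets => // s fs; apply/eqP; apply: contraT => nz.
  have /andP[_ /eqP card_s] := cyc.1 s nz.
  have [t [vt ft]] : exists t, valid_shape n q (shape t) /\ facet_of_shape (shape t) s.
    apply: facet_shape_ex => // i; apply: contraNN nz => is_.
    by rewrite (cycle_singleton cyc fs is_).
  have /ffunP/(_ t) := z0; rewrite !ffunE vt => /(shape_map_eq0 vt) /(_ s ft) e.
  by rewrite e eqxx in nz.
- move=> F modF.
  (* Choose a preimage for each shape, with facet coefficients confined to that shape, and zero for
     invalid shapes. Since a facet has only one sorted shape, the preimages do not interfere when
     summed. *)
  have /fin_all_exists[Z hZ] t : exists z, [/\ zcycle q z, shape_map (shape t) z = F t \/ ~~ valid_shape n q (shape t) &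
       forall s, isfacet s -> z s != 0 -> valid_shape n q (shape t) /\ facet_of_shape (shape t) s].
    have := modF t; case: ifPn => [vt indF|nvt _].
      have [z [cyc sh] e] := shape_map_surj vt n_gt1 indF.
      by exists z; split=> //; [left | move=> s fs /(sh s fs)].
    exists 0; split; [|by right | by move=> s _; rewrite ffunE eqxx].
    by have := @zcycle_sum void [::] (fun=> 0); rewrite big_nil; apply.
  exists (\sum_t Z t); first by apply: zcycle_sum => t; have [] := hZ t.
  apply/ffunP => t; rewrite ffunE; have := modF t; case: ifPn => [vt _|_ ->//].
  rewrite (big_morph _ (@shape_mapD n (shape t)) (id1 := 0)); last first.
    by apply/(shape_map_eq0 vt) => s _; rewrite ffunE.
  rewrite (bigD1 t) //= big1 ?addr0 => [|t' ne].
    by have [_ [//|]] := hZ t; rewrite vt.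
  apply/(shape_map_eq0 vt) => s ft; apply/eqP; apply: contraNT ne => nz.
  have [_ _ /(_ s _ nz)[|vt' ft']] := hZ t'; first by case/andP: ft.
  by apply/eqP/val_inj/(inj_map val_inj); apply: shape_unique vt' vt ft' ft.
move=> g z _; apply/ffunP => t; rewrite !ffunE; case: ifP => // vt.
  exact: shape_map_act.
by apply/ffunP => y; rewrite !ffunE.
Qed.

End DirectSum.

Theorem theorem2 (n q : nat) (hn : (2 <= n)%N) :
  (forall lam : seq nat, valid_shape n q lam ->
     (forall (g : 'S_n) (z : chain n),
         @Vlam n q lam z -> @Vlam n q lam (@cact n g z)) /\
     @ZSn_iso n _ (@Vlam n q lam) (@boundary n q) (@indmod n lam) (@indact n)) /\
  @ZSn_iso n _ (@zcycle n q) (@boundary n q) (@summod n q) (@sumact n q).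
Proof.
split; last exact: homology_iso.
by move=> lam lam_valid; split; [exact: Vlam_cact | exact: Vlam_iso].
Qed.
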